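(* Let $X$ be a countable set, let $\mathrm{DerNov}^!\langle X\rangle$ be the free $\mathrm{DerNov}^!$ algebra generated by $X$, and let $\mathrm{DerNov}^!_{\succ}\langle X\rangle$ be its subspace spanned by the monomials in $X$ containing only the operation $\succ$, regarded as an algebra under $\succ$. Then $\mathrm{DerNov}^!_{\succ}\langle X\rangle$ coincides with the free bicommutative algebra with additional identities (i.e. it is the free algebra on $X$ in the variety of bicommutative algebras satisfying these identities) $$((a\succ b)\succ c)\succ d=d\succ(c\succ(b\succ a))=c\succ(b\succ(a\succ d)),$$ $$((a\succ b)\succ c)\succ d=c\succ((d\succ a)\succ b)=b\succ((d\succ a)\succ c)=b\succ((c\succ a)\succ d).$$
   Context: All algebras are over a field of characteristic $0$. A $\mathrm{DerNov}^!$ algebra is a vector space with two bilinear operations $\prec,\succ$ satisfying $$a\prec(b\prec c)+(b\prec c)\succ a=0,\qquad a\prec(b\succ c)=0,$$ $$(a\prec b)\prec c-(c\prec b)\succ a=(a\prec c)\prec b-(b\prec c)\succ a,$$ $$(a\succ b)\prec c+c\succ(a\succ b)-(a\succ c)\succ b=0,\qquad a\succ(b\prec c)+(b\prec c)\succ a=0,$$ $$a\succ(b\succ c)=b\succ(a\succ c),\qquad (a\prec b)\succ c=(c\prec b)\succ a,\qquad (a\succ b)\succ c=(a\succ c)\succ b.$$ A bicommutative algebra is an algebra with one bilinear operation $\succ$ satisfying $(a\succ b)\succ c=(a\succ c)\succ b$ and $a\succ(b\succ c)=b\succ(a\succ c)$. *)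

(* Defs.v *)
From HB Require Import structures.
From mathcomp Require Import all_boot all_algebra boolp.

Set Implicit Arguments.
Unset Strict Implicit.
Unset Printing Implicit Defensive.

Import GRing.Theory.
Local Open Scope ring_scope.

Section Varieties.
Variables (K : fieldType) (V : lmodType K).

Section DerNovDual.
Variables prec succ : {bilinear V -> V -> V}.
Local Notation "a ≺ b" := (prec a b) (at level 45, no associativity).
Local Notation "a ≻ b" := (succ a b) (at level 45, no associativity).

Record is_dernov_dual : Prop := {
  dd_prec_prec a b c : (a ≺ (b ≺ c)) + ((b ≺ c) ≻ a) = 0;
  dd_prec_succ a b c : a ≺ (b ≻ c) = 0;
  dd_prec_prec_sym a b c :
    ((a ≺ b) ≺ c) - ((c ≺ b) ≻ a) = ((a ≺ c) ≺ b) - ((b ≺ c) ≻ a);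
  dd_succ_prec a b c :
    ((a ≻ b) ≺ c) + (c ≻ (a ≻ b)) - ((a ≻ c) ≻ b) = 0;
  dd_succ_precr a b c : (a ≻ (b ≺ c)) + ((b ≺ c) ≻ a) = 0;
  dd_lcomm a b c : a ≻ (b ≻ c) = b ≻ (a ≻ c);
  dd_prec_succ_sym a b c : (a ≺ b) ≻ c = (c ≺ b) ≻ a;
  dd_rcomm a b c : (a ≻ b) ≻ c = (a ≻ c) ≻ b
}.
End DerNovDual.

Section Bicommutative.
Variable succ : {bilinear V -> V -> V}.
Local Notation "a ≻ b" := (succ a b) (at level 45, no associativity).

Record is_bicommutative : Prop := {
  bc_rcomm a b c : (a ≻ b) ≻ c = (a ≻ c) ≻ b;
  bc_lcomm a b c : a ≻ (b ≻ c) = b ≻ (a ≻ c)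
}.

(* Each chain of identities is rendered by equating its first term to every
   other one. *)
Record extra_identities : Prop := {
  ex_chain1 a b c d :
    ((a ≻ b) ≻ c) ≻ d = d ≻ (c ≻ (b ≻ a)) /\
    ((a ≻ b) ≻ c) ≻ d = c ≻ (b ≻ (a ≻ d));
  ex_chain2 a b c d :
    [/\ ((a ≻ b) ≻ c) ≻ d = c ≻ ((d ≻ a) ≻ b),
        ((a ≻ b) ≻ c) ≻ d = b ≻ ((d ≻ a) ≻ c)
      & ((a ≻ b) ≻ c) ≻ d = b ≻ ((c ≻ a) ≻ d)]
}.

Definition is_special_bicommutative : Prop :=
  is_bicommutative /\ extra_identities.
End Bicommutative.
End Varieties.

Section Freeness.
Variables (K : fieldType) (X : Type).

Definition op_morphism (V W : lmodType K) (opV : {bilinear V -> V -> V})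
    (opW : {bilinear W -> W -> W}) (phi : V -> W) : Prop :=
  forall u v, phi (opV u v) = opW (phi u) (phi v).

(* Freeness is the universal property of i : X -> V; linear maps are compared
   pointwise since the packed type {linear V -> W} carries proofs. *)
Definition is_free_dernov_dual (V : lmodType K)
    (prec succ : {bilinear V -> V -> V}) (i : X -> V) : Prop :=
  is_dernov_dual prec succ /\
  forall (W : lmodType K) (precW succW : {bilinear W -> W -> W}),
    is_dernov_dual precW succW ->
  forall f : X -> W,
    let extends (phi : {linear V -> W}) :=
      [/\ op_morphism prec precW phi, op_morphism succ succW phi
        & forall x, phi (i x) = f x] in
    exists2 phi : {linear V -> W}, extends phi
      & forall psi : {linear V -> W}, extends psi -> psi =1 phi.

Definition is_free_special_bicommutative (V : lmodType K)
    (succ : {bilinear V -> V -> V}) (i : X -> V) : Prop :=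
  is_special_bicommutative succ /\
  forall (W : lmodType K) (succW : {bilinear W -> W -> W}),
    is_special_bicommutative succW ->
  forall f : X -> W,
    let extends (phi : {linear V -> W}) :=
      op_morphism succ succW phi /\ forall x, phi (i x) = f x in
    exists2 phi : {linear V -> W}, extends phi
      & forall psi : {linear V -> W}, extends psi -> psi =1 phi.
End Freeness.

Section SuccSubalgebra.
Variables (K : fieldType) (X : Type) (V : lmodType K).
Variables (succ : {bilinear V -> V -> V}) (i : X -> V).

Inductive succ_monomial : V -> Prop :=
| SuccGen x : succ_monomial (i x)
| SuccMul u v : succ_monomial u -> succ_monomial v -> succ_monomial (succ u v).

Definition in_succ_span (v : V) : Prop :=
  exists2 s : seq (K * V),
    forall p, p \in s -> succ_monomial p.2
    & v = \sum_(p <- s) p.1 *: p.2.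

Definition succ_span : pred V := fun v => `[< in_succ_span v >].

Lemma in_succ_spanP v : reflect (in_succ_span v) (v \in succ_span).
Proof. exact: asboolP. Qed.

Lemma in_succ_span0 : in_succ_span 0.
Proof. by exists [::]; rewrite ?big_nil. Qed.

Lemma in_succ_spanD u v :
  in_succ_span u -> in_succ_span v -> in_succ_span (u + v).
Proof.
move=> [s sP ->] [t tP ->]; exists (s ++ t); last by rewrite big_cat.
by move=> p; rewrite mem_cat => /orP[/sP|/tP].
Qed.

Lemma in_succ_spanZ a u : in_succ_span u -> in_succ_span (a *: u).
Proof.
move=> [s sP ->]; exists [seq (a * p.1, p.2) | p <- s].
  by move=> p /mapP[q /sP qP ->].
by rewrite big_map scaler_sumr; apply: eq_bigr => p _; rewrite scalerA.
Qed.

Lemma in_succ_span_monomial u : succ_monomial u -> in_succ_span u.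
Proof.
move=> uP; exists [:: (1, u)]; last by rewrite big_seq1 scale1r.
by move=> p; rewrite inE => /eqP ->.
Qed.

Lemma in_succ_span_sum (I : eqType) (s : seq I) (F : I -> V) :
  (forall k, k \in s -> in_succ_span (F k)) ->
  in_succ_span (\sum_(k <- s) F k).
Proof.
move=> FP; rewrite big_seq.
by apply: (big_ind in_succ_span);
  [exact: in_succ_span0 | exact: in_succ_spanD | exact: FP].
Qed.

Lemma in_succ_span_mul u v :
  in_succ_span u -> in_succ_span v -> in_succ_span (succ u v).
Proof.
move=> [s sP ->] [t tP ->]; rewrite linear_sumlz.
apply: in_succ_span_sum => p /sP pP; rewrite linear_sumr.
apply: in_succ_span_sum => q /tP qP; rewrite linearZl_LR linearZr_LR /=.
do 2!apply: in_succ_spanZ.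
exact/in_succ_span_monomial/SuccMul.
Qed.

Lemma succ_span_submod_closed : submod_closed succ_span.
Proof.
split; first exact/in_succ_spanP/in_succ_span0.
move=> a u v /in_succ_spanP uP /in_succ_spanP vP.
exact/in_succ_spanP/in_succ_spanD/vP/in_succ_spanZ.
Qed.

HB.instance Definition _ :=
  GRing.isSubmodClosed.Build K V succ_span succ_span_submod_closed.

Record succ_subalg : Type :=
  SuccSubalg { succ_subalg_val :> V; _ : succ_subalg_val \in succ_span }.

HB.instance Definition _ := [isSub for succ_subalg_val].
HB.instance Definition _ := [Choice of succ_subalg by <:].
HB.instance Definition _ := [SubChoice_isSubLmodule of succ_subalg by <:].

Lemma succ_subalg_mulP (u v : succ_subalg) : succ (val u) (val v) \in succ_span.
Proof.
by apply/in_succ_spanP/in_succ_span_mul; apply/in_succ_spanP; exact: valP.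
Qed.

Definition succ_subalg_mul (u v : succ_subalg) : succ_subalg :=
  SuccSubalg (succ_subalg_mulP u v).

Lemma succ_subalg_mul_bilinear :
  bilinear_for *:%R *:%R succ_subalg_mul.
Proof.
by split=> [w|w] a u v; apply: val_inj; rewrite /= linearPl + rewrite /= linearPr.
Qed.

HB.instance Definition _ :=
  bilinear_isBilinear.Build K succ_subalg succ_subalg succ_subalg
    *:%R *:%R succ_subalg_mul succ_subalg_mul_bilinear.

Lemma succ_subalg_genP x : i x \in succ_span.
Proof. exact/in_succ_spanP/in_succ_span_monomial/SuccGen. Qed.

Definition succ_subalg_gen (x : X) : succ_subalg :=
  SuccSubalg (succ_subalg_genP x).
End SuccSubalgebra.

Arguments succ_subalg_mul {K X V} succ i u v.
Arguments succ_subalg_gen {K X V} succ i x.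

(* Main.v *)
Require Import Defs.
From HB Require Import structures.
From mathcomp Require Import all_boot all_algebra.
From mathcomp Require Import boolp functions.

Set Implicit Arguments.
Unset Strict Implicit.
Unset Printing Implicit Defensive.

Import GRing.Theory.

Local Open Scope ring_scope.

(** There are two things to prove: the listed identities hold for [≻] in every
DerNov^! algebra, and no further ones hold in the free one.

The identities all say the same thing: in degree four the five bracketings
agree, and their common value is a symmetric function of the four factors.
In a DerNov^! algebra this comes from [(a ≻ b) ≺ c = (a ≻ c) ≻ b - c ≻ (a ≻ b)]:
the other mixed identities force this element to annihilate the algebra on both
sides under [≻], which lets one rebracket inside any fourfold product
([dernov_dual_special_bicommutative]).

For the converse, let W be an algebra with one operation [≻] that satisfies the
identities, and let f : X -> W.  It would be enough to define [≺] on W, but [≺]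
should send the pair of [a ≻ b] and c to the defect
[(a ≻ c) ≻ b - c ≻ (a ≻ b)], which need not be a function of [a ≻ b] and c
alone, and which has to be used only for a, b, c of degree one.  So W is
replaced by a larger algebra, the cover, that remembers just enough of a
grading: an element is a triple (s, a, h), where s is an element of W, a is its
part of degree one, and h : W -> W is the operator by which its part of degree
two acts through [≺] on elements of degree one.  The products are
  (s, a, h) ≻ (s', a', h') = (s ≻ s', 0, defect a a')
  (s, a, h) ≺ (s', a', h') = (h a', 0, 0).
By the symmetry of fourfold products in W, a defect annihilates W and the defect
vanishes when one of its arguments is a product.  Accordingly, in a triple, h is
required to be linear with values that annihilate W, and the defect is required
to vanish as soon as one of its arguments is s - a.  With these conditions the
cover is a DerNov^! algebra ([cover_is_dernov_dual]).

The map (s, a, h) |-> s is a morphism for [≻], and f lifts along it by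
x |-> (f x, f x, 0).  Hence the morphism from the free DerNov^! algebra to the
cover, followed by this projection and restricted to the span of the
[≻]-monomials, is the required extension of f.  It is unique because the
[≻]-monomials are products of generators
([succ_subalg_morphism_unique]). *)

(** * Symmetry of fourfold products *)

Section SpecialBicommutative.
Variables (K : fieldType) (V : lmodType K) (succ : {bilinear V -> V -> V}).
Local Notation "a ≻ b" := (succ a b) (at level 45, no associativity).

(** The first hypothesis is the key: its left side is symmetric in b, c, d by
right commutativity and its right side is symmetric in a, b, c by left
commutativity, and these two groups generate all permutations. *)
Lemma special_bicommutative_of_bracketings :
    is_bicommutative succ ->
    (forall a b c d, ((a ≻ b) ≻ c) ≻ d = c ≻ (b ≻ (a ≻ d))) ->
    (forall a b c d, ((a ≻ b) ≻ c) ≻ d = c ≻ ((d ≻ a) ≻ b)) ->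
  is_special_bicommutative succ.
Proof.
move=> succB S_left S_mid; have [rC lC] := succB.
have S12 a b c d : ((a ≻ b) ≻ c) ≻ d = ((b ≻ a) ≻ c) ≻ d.
  by rewrite !S_left (lC b).
have S23 a b c d : ((a ≻ b) ≻ c) ≻ d = ((a ≻ c) ≻ b) ≻ d by rewrite (rC a).
have S34 a b c d : ((a ≻ b) ≻ c) ≻ d = ((a ≻ b) ≻ d) ≻ c by exact: rC.
split=> //; split=> a b c d; split.
- by rewrite -S_left S12 S23 S34.
- exact: S_left.
- exact: S_mid.
- by rewrite -S_mid S23.
- by rewrite -S_mid S34 S23.
Qed.

Hypothesis succS : is_special_bicommutative succ.

Lemma succC_right a b c : (a ≻ b) ≻ c = (a ≻ c) ≻ b.
Proof. by have [[]] := succS. Qed.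

Lemma succC_left a b c : a ≻ (b ≻ c) = b ≻ (a ≻ c).
Proof. by have [[]] := succS. Qed.

(** The next two lemmas bring a fourfold product to the left-nested form
[((_ ≻ _) ≻ _) ≻ _]; the remaining bracketings reach the forms that they treat by
commutativity.  Two left-nested products of the same factors are then
compared by the adjacent transpositions below. *)
Lemma succ_left_nested a b c d : a ≻ (b ≻ (c ≻ d)) = ((c ≻ b) ≻ a) ≻ d.
Proof. by have [_ [/(_ c b a d)[]]] := succS. Qed.

Lemma succ_mid_nested a b c d : a ≻ ((b ≻ c) ≻ d) = ((c ≻ d) ≻ a) ≻ b.
Proof. by have [_ [_ /(_ c d a b)[]]] := succS. Qed.

Lemma succ_swap12 a b c d : ((a ≻ b) ≻ c) ≻ d = ((b ≻ a) ≻ c) ≻ d.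
Proof. by rewrite -!succ_left_nested (succC_left b). Qed.

Lemma succ_swap34 a b c d : ((a ≻ b) ≻ c) ≻ d = ((a ≻ b) ≻ d) ≻ c.
Proof. exact: succC_right. Qed.

Lemma succ_swap23 a b c d : ((a ≻ b) ≻ c) ≻ d = ((a ≻ c) ≻ b) ≻ d.
Proof. by rewrite (succC_right a). Qed.
End SpecialBicommutative.

Section DerNovDualIdentities.
Variables (K : fieldType) (V : lmodType K).
Variables prec succ : {bilinear V -> V -> V}.
Hypothesis dd : is_dernov_dual prec succ.
Local Notation "a ≺ b" := (prec a b) (at level 45, no associativity).
Local Notation "a ≻ b" := (succ a b) (at level 45, no associativity).

Lemma prec_of_succ a b c : (a ≻ b) ≺ c = ((a ≻ c) ≻ b) - (c ≻ (a ≻ b)).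
Proof.
by apply/eqP; rewrite -subr_eq0 opprB addrA (dd_succ_prec dd).
Qed.

(** The product is the opposite of [d ≺ ((a ≻ b) ≺ c)], and expanding the inner
[≺] there leaves only terms of the form [d ≺ (_ ≻ _)], which are zero. *)
Lemma prec_of_succ_annihilates_right a b c d : ((a ≻ b) ≺ c) ≻ d = 0.
Proof.
have := dd_prec_prec dd d (a ≻ b) c.
by rewrite {1}prec_of_succ linearBr /= !(dd_prec_succ dd) subr0 add0r.
Qed.

Lemma prec_of_succ_annihilates_left a b c d : d ≻ ((a ≻ b) ≺ c) = 0.
Proof.
have := dd_succ_precr dd d (a ≻ b) c.
by rewrite prec_of_succ_annihilates_right addr0.
Qed.

(** The two annihilation lemmas say that, inside a larger product,
[(a ≻ c) ≻ b] may be replaced by [c ≻ (a ≻ b)].  Together with the two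
commutativities this turns a left-nested product into the other bracketings. *)
Lemma dernov_dual_special_bicommutative : is_special_bicommutative succ.
Proof.
have [lC rC] := (dd_lcomm dd, dd_rcomm dd).
have flip_right a b c d : ((a ≻ b) ≻ c) ≻ d = (c ≻ (a ≻ b)) ≻ d.
  apply/eqP; rewrite -subr_eq0 -linearBl /= (rC a) -prec_of_succ.
  by rewrite prec_of_succ_annihilates_right.
have flip_left a b c d : d ≻ ((a ≻ b) ≻ c) = d ≻ (b ≻ (a ≻ c)).
  apply/eqP; rewrite -subr_eq0 -linearBr /= -prec_of_succ.
  by rewrite prec_of_succ_annihilates_left.
have S_left' a b c d : ((a ≻ b) ≻ c) ≻ d = a ≻ (d ≻ (c ≻ b)).
  by rewrite flip_right rC lC flip_left.
apply: special_bicommutative_of_bracketings => // a b c d.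
- by rewrite (rC (a ≻ b) c d) (rC a b d) S_left' (lC a c) (lC a b).
- by rewrite (rC (a ≻ b) c d) S_left' flip_left lC.
Qed.
End DerNovDualIdentities.

(** * The cover of a special bicommutative algebra *)

Section Cover.
Variables (K : fieldType) (W : lmodType K) (m : {bilinear W -> W -> W}).
Local Notation "a ≻ b" := (m a b) (at level 45, no associativity).

(** The value that [(a ≻ b) ≺ c] is forced to take in a DerNov^! algebra; its
bilinear dependence on the pair (a, b) does not factor through [a ≻ b] in
general. *)
Definition defect a b c := ((a ≻ c) ≻ b) - (c ≻ (a ≻ b)).

Lemma defectDl a a' b c : defect (a + a') b c = defect a b c + defect a' b c.
Proof. by rewrite /defect !(linearDl, linearDr) /= opprD addrACA. Qed.

Lemma defectDm a b b' c : defect a (b + b') c = defect a b c + defect a b' c.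
Proof. by rewrite /defect !(linearDl, linearDr) /= opprD addrACA. Qed.

Lemma defectDr a b c c' : defect a b (c + c') = defect a b c + defect a b c'.
Proof. by rewrite /defect !(linearDl, linearDr) /= opprD addrACA. Qed.

Lemma defectZl k a b c : defect (k *: a) b c = k *: defect a b c.
Proof. by rewrite /defect !(linearZl_LR, linearZr_LR) /= scalerBr. Qed.

Lemma defectZm k a b c : defect a (k *: b) c = k *: defect a b c.
Proof. by rewrite /defect !(linearZl_LR, linearZr_LR) /= scalerBr. Qed.

Lemma defectZr k a b c : defect a b (k *: c) = k *: defect a b c.
Proof. by rewrite /defect !(linearZl_LR, linearZr_LR) /= scalerBr. Qed.

Lemma defect0l b c : defect 0 b c = 0.
Proof. by rewrite -[X in defect X](scale0r 0) defectZl scale0r. Qed.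

Lemma defect0m a c : defect a 0 c = 0.
Proof. by rewrite -[X in defect _ X](scale0r 0) defectZm scale0r. Qed.

Lemma defect0r a b : defect a b 0 = 0.
Proof. by rewrite -[X in defect _ _ X](scale0r 0) defectZr scale0r. Qed.

Definition annihilates d := forall u, d ≻ u = 0 /\ u ≻ d = 0.

(** Stands for the elements of degree at least two: they are invisible to the
defect, which therefore depends only on the parts of degree one. *)
Definition defect_free d :=
  forall u v, [/\ defect d u v = 0, defect u d v = 0 & defect u v d = 0].

Lemma annihilates_linear k d d' :
  annihilates d -> annihilates d' -> annihilates (k *: d + d').
Proof.
move=> dP d'P u; have [[dl dr] [d'l d'r]] := (dP u, d'P u).
by rewrite linearPl linearPr /= dl dr d'l d'r scaler0 addr0.
Qed.

Lemma defect_free_linear k d d' :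
  defect_free d -> defect_free d' -> defect_free (k *: d + d').
Proof.
move=> dP d'P u v; have [d1 d2 d3] := dP u v; have [e1 e2 e3] := d'P u v.
rewrite defectDl defectDm defectDr defectZl defectZm defectZr.
by rewrite d1 d2 d3 e1 e2 e3 scaler0 addr0.
Qed.

Lemma annihilates_defect_free d : annihilates d -> defect_free d.
Proof.
move=> dP u v; rewrite /defect.
have dl w : d ≻ w = 0 := (dP w).1; have dr w : w ≻ d = 0 := (dP w).2.
by rewrite !(dl, dr, linear0l, linear0r) /= subrr.
Qed.

Definition is_cover_element (p : W * W * (W -> W)) :=
  [/\ defect_free (p.1.1 - p.1.2), linear p.2
    & forall w, annihilates (p.2 w)].

Definition cover_pred : pred (W * W * (W -> W)) :=
  fun p => `[< is_cover_element p >].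

Lemma cover_predP p : reflect (is_cover_element p) (p \in cover_pred).
Proof. exact: asboolP. Qed.

Lemma cover_submod_closed : submod_closed cover_pred.
Proof.
split.
  apply/cover_predP; split=> [||w u] /=.
  - by rewrite subrr => u v; rewrite defect0l defect0m defect0r.
  - by move=> k u v; rewrite /= scaler0 addr0.
  - by rewrite !(linear0l, linear0r).
move=> k p q /cover_predP[p1 p2 p3] /cover_predP[q1 q2 q3].
apply/cover_predP; split=> [||w] /=.
- rewrite opprD addrACA -scalerBr; exact: defect_free_linear.
- move=> l u v; rewrite !fctE /= p2 q2.
  rewrite !scalerDr !scalerA mulrC -!addrA; congr (_ + _).
  by rewrite addrCA.
- exact: annihilates_linear.
Qed.

HB.instance Definition _ :=
  GRing.isSubmodClosed.Build K (W * W * (W -> W))%type cover_pred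
    cover_submod_closed.

Record cover : Type := Cover { cover_val; _ : cover_val \in cover_pred }.

HB.instance Definition _ := [isSub for cover_val].
HB.instance Definition _ := [Choice of cover by <:].
HB.instance Definition _ := [SubChoice_isSubLmodule of cover by <:].

Definition total (x : cover) : W := (val x).1.1.
Definition degree1 (x : cover) : W := (val x).1.2.
Definition degree2_action (x : cover) : W -> W := (val x).2.

Lemma cover_eqP x y :
  total x = total y -> degree1 x = degree1 y ->
  degree2_action x =1 degree2_action y -> x = y.
Proof.
move: x y => [[[s a] h] sP] [[[s' a'] h'] s'P].
rewrite /total /degree1 /degree2_action /= => eqs eqa /funext eqh.
by apply: val_inj; rewrite /= eqs eqa eqh.
Qed.

Lemma cover_split x : exists2 n, defect_free n & total x = degree1 x + n.
Proof.
have /cover_predP[nP _ _] := valP x.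
by exists (total x - degree1 x); rewrite // addrC subrK.
Qed.

Lemma degree2_action_linear x : linear (degree2_action x).
Proof. by have /cover_predP[] := valP x. Qed.

Lemma degree2_action0 x : degree2_action x 0 = 0.
Proof.
have := degree2_action_linear x (-1) 0 0.
by rewrite scaler0 addr0 scaleN1r addNr.
Qed.

Lemma degree2_action_annihilates x w : annihilates (degree2_action x w).
Proof. by have /cover_predP[_ _] := valP x; apply. Qed.

Lemma totalP k x y : total (k *: x + y) = k *: total x + total y.
Proof. by []. Qed.

HB.instance Definition _ := GRing.isLinear.Build K cover W *:%R total totalP.

(** This is what makes the identity expressing [(x ≻ y) ≺ z] through [≻] hold:
the left side sees only the parts of degree one, and the right side is computed
from the whole elements. *)
Lemma defect_total x y z :
  defect (total x) (total y) (total z)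
  = defect (degree1 x) (degree1 y) (degree1 z).
Proof.
have [n nP ->] := cover_split x; have [p pP ->] := cover_split y.
have [q qP ->] := cover_split z.
have dn u v := let: And3 e _ _ := nP u v in e.
have dp u v := let: And3 _ e _ := pP u v in e.
have dq u v := let: And3 _ _ e := qP u v in e.
by rewrite defectDl dn addr0 defectDm dp addr0 defectDr dq addr0.
Qed.

Lemma cover_gen_subproof w : (w, w, 0) \in cover_pred.
Proof.
apply/cover_predP; split=> [||v u] /=.
- by rewrite subrr => u v; rewrite defect0l defect0m defect0r.
- by move=> k u v; rewrite scaler0 addr0.
- by rewrite linear0l linear0r.
Qed.

Definition cover_gen (w : W) : cover := Cover (cover_gen_subproof w).

(** * The two products of the cover *)

Lemma cover_prec_subproof x y :
  (degree2_action x (degree1 y), 0, 0) \in cover_pred.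
Proof.
apply/cover_predP; split=> [||v u] /=.
- rewrite subr0; apply: annihilates_defect_free.
  exact: degree2_action_annihilates.
- by move=> k u v; rewrite scaler0 addr0.
- by rewrite linear0l linear0r.
Qed.

Definition cover_prec x y : cover := Cover (cover_prec_subproof x y).

Lemma cover_prec_bilinear : bilinear_for *:%R *:%R cover_prec.
Proof.
split=> [w|w] k u v; apply: cover_eqP => [||c] //=.
all: rewrite /total /degree1 /degree2_action /= ?scaler0 ?addr0 //.
all: try exact: degree2_action_linear.
Qed.

HB.instance Definition _ :=
  bilinear_isBilinear.Build K cover cover cover
    *:%R *:%R cover_prec cover_prec_bilinear.

Hypothesis succS : is_special_bicommutative m.

Let rC := succC_right succS.
Let lC := succC_left succS.
Let left_nested := succ_left_nested succS.
Let mid_nested := succ_mid_nested succS.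
Let swap12 := succ_swap12 succS.
Let swap23 := succ_swap23 succS.
Let swap34 := succ_swap34 succS.

(** The two terms of a defect, multiplied by d, are fourfold products of the same
factors, hence equal. *)
Lemma defect_annihilates a b c : annihilates (defect a b c).
Proof.
move=> d; rewrite /defect linearBl linearBr /=; split; apply/eqP.
- rewrite subr_eq0 (rC c) (lC (c ≻ d)) mid_nested.
  by rewrite (swap34 a c b d) (swap23 a c d b) (swap12 a d c b)
    (swap34 d a c b) (swap23 d a b c).
- rewrite subr_eq0 mid_nested left_nested (swap34 c b d a).
  by rewrite (swap23 c b a d) (swap12 c a b d) (swap34 a c b d).
Qed.

Lemma mul_defect_free u v : defect_free (u ≻ v).
Proof.
move=> b c; rewrite /defect; split; apply/eqP; rewrite subr_eq0.
- rewrite mid_nested (swap34 v b c u) (swap23 v b u c) (swap12 v u b c).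
  by rewrite (swap34 u v b c).
- rewrite (lC (b ≻ c)) mid_nested left_nested.
  rewrite (swap34 c v u b) (swap23 c v b u) (swap34 c b v u) (swap12 c b u v).
  by rewrite (swap23 b c u v) (swap12 b u c v).
- rewrite (rC b) (lC (b ≻ c)) (lC (u ≻ v)) !mid_nested (swap12 c v u b).
  by rewrite (swap34 v c u b).
Qed.

Lemma cover_succ_subproof x y :
  (total x ≻ total y, 0, defect (degree1 x) (degree1 y)) \in cover_pred.
Proof.
apply/cover_predP; split=> [||w] /=; last exact: defect_annihilates.
  rewrite subr0; exact: mul_defect_free.
by move=> k u v; rewrite defectDr defectZr.
Qed.

Definition cover_succ x y : cover := Cover (cover_succ_subproof x y).

Lemma cover_succ_bilinear : bilinear_for *:%R *:%R cover_succ.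
Proof.
split=> [w|w] k u v; apply: cover_eqP => [||c].
- exact: linearPl.
- by rewrite /degree1 /= scaler0 addr0.
- exact: etrans (defectDl _ _ _ _) (congr1 (+%R^~ _) (defectZl _ _ _ _)).
- exact: linearPr.
- by rewrite /degree1 /= scaler0 addr0.
- exact: etrans (defectDm _ _ _ _) (congr1 (+%R^~ _) (defectZm _ _ _ _)).
Qed.

HB.instance Definition _ :=
  bilinear_isBilinear.Build K cover cover cover
    *:%R *:%R cover_succ cover_succ_bilinear.

Local Notation "x ≻' y" := (cover_succ x y) (at level 45, no associativity).
Local Notation "x ≺' y" := (cover_prec x y) (at level 45, no associativity).

Lemma cover_prec0 x y : degree1 y = 0 -> x ≺' y = 0.
Proof.
by move=> y0; apply: cover_eqP => //; rewrite /total /= y0 degree2_action0.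
Qed.

Lemma cover_prec_succl x y z : (x ≺' y) ≻' z = 0.
Proof.
apply: cover_eqP => [||c] //; first exact: (degree2_action_annihilates _ _ _).1.
exact: defect0l.
Qed.

Lemma cover_prec_succr x y z : x ≻' (y ≺' z) = 0.
Proof.
apply: cover_eqP => [||c] //; first exact: (degree2_action_annihilates _ _ _).2.
exact: defect0m.
Qed.

Lemma cover_prec_of_succ x y z :
  (x ≻' y) ≺' z = ((x ≻' z) ≻' y) - (z ≻' (x ≻' y)).
Proof.
apply: cover_eqP => [||c]; first exact/esym/defect_total.
- by rewrite /degree1 /= subrr.
- by rewrite /degree2_action /= !fctE defect0l defect0m subrr.
Qed.

Lemma cover_is_dernov_dual : is_dernov_dual cover_prec cover_succ.
Proof.
split=> x y z /=; rewrite ?cover_prec_succl ?cover_prec_succr ?addr0 //.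
- exact: cover_prec0.
- exact: cover_prec0.
- by rewrite !subr0; apply: cover_eqP.
- by rewrite cover_prec_of_succ addrNK subrr.
- apply: cover_eqP => [||c] //; first exact: lC.
  by rewrite /degree2_action /= !defect0m.
- apply: cover_eqP => [||c] //; first exact: rC.
  by rewrite /degree2_action /= !defect0l.
Qed.
End Cover.

(** * The subalgebra spanned by the [≻]-monomials *)

Section SuccSubalgebra.
Variables (K : fieldType) (X : Type) (V : lmodType K).
Variables (succ : {bilinear V -> V -> V}) (i : X -> V).

Lemma succ_subalg_special_bicommutative :
  is_special_bicommutative succ ->
  is_special_bicommutative (succ_subalg_mul succ i).
Proof.
move=> [[rC lC] [c1 c2]]; split.
  by split=> a b c; apply: val_inj; [exact: rC | exact: lC].
split=> a b c d; split; apply: val_inj.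
all: by have [[? ?] [? ? ?]] :=
  (c1 (val a) (val b) (val c) (val d), c2 (val a) (val b) (val c) (val d)).
Qed.

Lemma succ_subalg_morphism_unique (W : lmodType K) (m : {bilinear W -> W -> W})
    (phi psi : {linear succ_subalg succ i -> W}) :
  op_morphism (succ_subalg_mul succ i) m phi ->
  op_morphism (succ_subalg_mul succ i) m psi ->
  (forall x, phi (succ_subalg_gen succ i x) = psi (succ_subalg_gen succ i x)) ->
  phi =1 psi.
Proof.
move=> phiM psiM eq_gen.
(* A monomial is a vector of V; the induction exhibits it as the value of an
   element of the subalgebra, where phi and psi make sense. *)
have eq_mon u : succ_monomial succ i u ->
    exists2 w : succ_subalg succ i, val w = u & phi w = psi w.
  elim=> [x|{}u v _ [w <- eqw] _ [w' <- eqw']].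
    by exists (succ_subalg_gen succ i x).
  by exists (succ_subalg_mul succ i w w'); rewrite // phiM psiM eqw eqw'.
move=> w; have /in_succ_spanP[s sP ws] := valP w.
suff [w' w'w eqw'] : exists2 w' : succ_subalg succ i, val w' = val w
    & phi w' = psi w' by rewrite -(val_inj w'w).
rewrite ws; elim: s sP {ws} => [|p s IHs] sP.
  by exists 0; rewrite ?big_nil // !linear0.
have [u up equ] := eq_mon _ (sP p (mem_head _ _)).
have [|v vs eqv] := IHs; first by move=> q qs; apply: sP; rewrite inE qs orbT.
exists (p.1 *: u + v); last by rewrite !linearP equ eqv.
by rewrite big_cons -up -vs.
Qed.
End SuccSubalgebra.

Theorem theorem2 (K : fieldType) (charK0 : [pchar K] =i pred0)
    (X : countType)
    (F : lmodType K) (prec succ : {bilinear F -> F -> F}) (i : X -> F)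
    (freeF : is_free_dernov_dual prec succ i) :
  is_free_special_bicommutative
    (succ_subalg_mul succ i) (succ_subalg_gen succ i).
Proof.
have [ddF univF] := freeF; split.
  apply: succ_subalg_special_bicommutative.
  exact: dernov_dual_special_bicommutative ddF.
move=> W m mS f.
have [Phi [_ PhiM Phi_gen] _] :=
  univF _ _ _ (cover_is_dernov_dual mS) (fun x => cover_gen m (f x)).
pose phi : {linear succ_subalg succ i -> W} :=
  (@total K W m : {linear _ -> _}) \o
    ((Phi : {linear _ -> _}) \o (val : {linear succ_subalg succ i -> F})).
have phiM : op_morphism (succ_subalg_mul succ i) m phi.
  by move=> u v; rewrite /phi /= PhiM.
have phi_gen x : phi (succ_subalg_gen succ i x) = f x.
  by rewrite /phi /= Phi_gen.
exists phi => [//|psi [psiM psi_gen]].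
by apply: succ_subalg_morphism_unique psiM phiM _ => x; rewrite psi_gen phi_gen.
Qed.
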